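(* Let $n \in \mathbb{N}$ be such that $n > 1$. Then $$(n)\mathbf{t} = \sum_{k=1}^{n} (k)\mathbf{s} \qquad\text{and}\qquad (n)\mathbf{i} = \sum_{k=0}^{n} (k)\mathbf{s} = (n)\mathbf{t} + 1 .$$
   Context: $\mathbb{N} = \{0, 1, 2, \ldots\}$. Functions are written to the right of their arguments, so $(n)\mathbf{s}$ denotes the value of $\mathbf{s}$ at $n$. For $n \in \mathbb{N}$: $S_n$ is the symmetric group of all permutations of $\{1,\ldots,n\}$; $T_n$ is the full transformation monoid of all functions from $\{1,\ldots,n\}$ to itself under composition; $I_n$ is the symmetric inverse monoid of all bijections between subsets of $\{1,\ldots,n\}$ (including the empty map), under composition of binary relations. Submonoids and inverse submonoids contain the identity of the ambient monoid. A monoid $M$ is monogenic if there is $m \in M$ with $M = \{m^j : j \in \mathbb{N}\}$, where $m^0$ is the identity of $M$. An inverse monoid $M$ is a monogenic inverse monoid if there is $m \in M$ such that $M$ is generated as a monoid by $m$ and $m^{-1}$. A monogenic inverse submonoid of $I_n$ is an inverse submonoid of $I_n$ that is a monogenic inverse monoid. The functions $\mathbf{s}, \mathbf{t}, \mathbf{i} : \mathbb{N} \to \mathbb{N}$ are defined as follows: - $(n)\mathbf{s}$ is the number of isomorphism types of cyclic subgroups of $S_n$ (equivalently, the number of distinct orders of elements of $S_n$), with $(0)\mathbf{s} = 1$ and $(1)\mathbf{s} = 1$; - $(n)\mathbf{t}$ is the number of isomorphism types of monogenic submonoids of $T_n$; - $(n)\mathbf{i}$ is the number of isomorphism types of monogenic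 inverse submonoids of $I_n$. *)

(* Defs.v *)
From HB Require Import structures.
From mathcomp Require Import all_boot all_fingroup all_solvable.
From mathcomp Require Import boolp.

Set Implicit Arguments.
Unset Strict Implicit.
Unset Printing Implicit Defensive.

Local Open Scope group_scope.

Definition monogenic (M : monoidType) (A : {pred M}) : Prop :=
  exists m : M, forall x, x \in A <-> exists j : nat, x = m ^+ j.

Definition submonoid (M : monoidType) (A : {pred M}) : Prop :=
  monoid_closed A.

Definition submonoid_generated_by (M : monoidType) (X A : {pred M}) : Prop :=
  forall x, x \in A <->
    forall B : {pred M}, submonoid B -> {subset X <= B} -> x \in B.

Definition inverse_submonoid (M : starMonoidType) (A : {pred M}) : Prop :=
  submonoid A /\ {in A, forall x, x^-1 \in A}.

Definition monogenic_inverse (M : starMonoidType) (A : {pred M}) : Prop :=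
  exists m : M, submonoid_generated_by (pred2 m m^-1) A.

(* On inverse submonoids an isomorphism of monoids automatically commutes    *)
(* with inversion, so the same relation serves for inverse monoids.          *)
Definition monoid_iso (M N : monoidType) (A : {pred M}) (B : {pred N}) : Prop :=
  exists f : M -> N,
    [/\ f 1 = 1, {in A &, {morph f : x y / x * y}}, {in A &, injective f}
      & forall y, y \in B <-> exists2 x, x \in A & y = f x].

(* Functions act on the right, as permutations do in 'S_n: x (f * g) is      *)
(* g (f x). The alias hides the pointwise product of {ffun _ -> _}.          *)
Definition transf (n : nat) := {ffun 'I_n -> 'I_n}.

Section FullTransformationMonoid.
Variable n : nat.

HB.instance Definition _ := Finite.on (transf n).

Definition transf_one : transf n := [ffun x => x].
Definition transf_mul (f g : transf n) : transf n := [ffun x => g (f x)].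

Fact transf_mulA : associative transf_mul.
Proof. by move=> f g h; apply/ffunP=> x; rewrite !ffunE. Qed.

Fact transf_mul1 : left_id transf_one transf_mul.
Proof. by move=> f; apply/ffunP=> x; rewrite !ffunE. Qed.

Fact transf_mulr1 : right_id transf_one transf_mul.
Proof. by move=> f; apply/ffunP=> x; rewrite !ffunE. Qed.

HB.instance Definition _ :=
  isMonoid.Build (transf n) transf_mulA transf_mul1 transf_mulr1.

End FullTransformationMonoid.

Definition partial_bijection (n : nat) (r : {set 'I_n * 'I_n}) : bool :=
  [forall p in r, forall q in r, (p.1 == q.1) == (p.2 == q.2)].

Record pbij (n : nat) := PBij {
  graph :> {set 'I_n * 'I_n};
  graphP : partial_bijection graph
}.

HB.instance Definition _ n := [isSub for @graph n].
HB.instance Definition _ n := [Finite of pbij n by <:].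

Section SymmetricInverseMonoid.
Variable n : nat.
Implicit Types r s t : pbij n.

Lemma pbijP r x y x' y' :
  (x, y) \in graph r -> (x', y') \in graph r -> (x == x') = (y == y').
Proof.
move=> rxy rxy'; have /forall_inP/(_ _ rxy)/forall_inP/(_ _ rxy') := graphP r.
by move/eqP.
Qed.

Definition graph_one : {set 'I_n * 'I_n} := [set p | p.1 == p.2].
Definition graph_mul r s : {set 'I_n * 'I_n} :=
  [set p | [exists y, ((p.1, y) \in graph r) && ((y, p.2) \in graph s)]].
Definition graph_inv r : {set 'I_n * 'I_n} := [set p | (p.2, p.1) \in graph r].

Fact graph_oneP : partial_bijection graph_one.
Proof.
apply/forall_inP=> -[x y] /[!inE]/eqP/= <-; apply/forall_inP=> -[x' y'] /[!inE].
by move=> /eqP/= <-.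
Qed.

Fact graph_mulP r s : partial_bijection (graph_mul r s).
Proof.
apply/forall_inP=> -[x z] /[!inE]/existsP[y /andP[/= rxy syz]].
apply/forall_inP=> -[x' z'] /[!inE]/existsP[y' /andP[/= rxy' syz']].
by rewrite (pbijP rxy rxy') (pbijP syz syz').
Qed.

Fact graph_invP r : partial_bijection (graph_inv r).
Proof.
apply/forall_inP=> -[x y] /[!inE]/= ryx.
by apply/forall_inP=> -[x' y'] /[!inE]/= ryx'; rewrite (pbijP ryx ryx').
Qed.

Definition pbij_one := PBij graph_oneP.
Definition pbij_mul r s := PBij (graph_mulP r s).
Definition pbij_inv r := PBij (graph_invP r).

Fact pbij_mulA : associative pbij_mul.
Proof.
move=> r s t; apply/val_inj/setP=> -[x w] /[!inE]/=.
apply/existsP/existsP => [[y]|[z]] /[!inE]/= /andP[].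
  move=> rxy /existsP[z /andP[syz tzw]]; exists z; rewrite inE /= tzw andbT.
  by apply/existsP; exists y; rewrite rxy.
move=> /existsP[y /andP[rxy syz]] tzw; exists y; rewrite inE /= rxy.
by apply/existsP; exists z; rewrite syz.
Qed.

Fact pbij_mul1 : left_id pbij_one pbij_mul.
Proof.
move=> r; apply/val_inj/setP=> -[x y] /[!inE]/=.
apply/existsP/idP => [[z] /[!inE]/= /andP[/eqP<-] // | rxy].
by exists x; rewrite inE eqxx.
Qed.

Fact pbij_invK : involutive pbij_inv.
Proof. by move=> r; apply/val_inj/setP=> -[x y] /[!inE]. Qed.

Fact pbij_invM : {morph pbij_inv : r s / pbij_mul r s >-> pbij_mul s r}.
Proof.
move=> r s; apply/val_inj/setP=> -[x y] /[!inE]/=.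
by apply: eq_existsb => z; rewrite !inE andbC.
Qed.

HB.instance Definition _ :=
  isStarMonoid.Build (pbij n) pbij_mulA pbij_mul1 pbij_invK pbij_invM.

End SymmetricInverseMonoid.

Definition num_types (T : finType) (iso : T -> T -> Prop) (P : T -> Prop) : nat :=
  #|equivalence_partition (fun A B => `[< iso A B >]) [set A | `[< P A >]]|.

Definition seq_s (n : nat) : nat :=
  num_types (fun G H : {group 'S_n} => G \isog H) (fun G => cyclic G).

Definition seq_t (n : nat) : nat :=
  num_types (fun A B : {set transf n} => monoid_iso A B)
            (fun A => submonoid A /\ monogenic A).

Definition seq_i (n : nat) : nat :=
  num_types (fun A B : {set pbij n} => monoid_iso A B)
            (fun A => inverse_submonoid A /\ monogenic_inverse A).

(* Main.v *)
Require Import Defs.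
From mathcomp Require Import all_boot all_fingroup all_solvable.
From mathcomp Require Import boolp zify.

(** Let [m] have index [i] and period [r]: its powers are distinct up to the
    exponent [i] and repeat with least period [r] from there on. The pair [(i, r)] is a
    complete invariant of the isomorphism type of what [m] generates, both for
    monogenic submonoids of the full transformation monoid and for monogenic
    inverse submonoids of the symmetric inverse monoid. It remains to find the
    pairs that occur in degree [n].

    The invariant is complete because equality between expressions in the
    generator depends on [i] and [r] only ([monoid_iso_of_kernel]). For powers
    this is [expg_eq_index_period]. For words in a partial bijection [m] and
    its inverse it is [word_eq_index_period]: the trajectories of [m] are
    cycles, on which a word acts as a power of [m] and only the exponent
    modulo [r] matters, and chains, of which the longest has exactly [i]
    points and determines what a word does on the others. Conversely, every
    element [x] of the generated monoid satisfies [x ^+ (i + r) = x ^+ i], and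
    this law is preserved by isomorphisms ([monoid_iso_index_period]).

    For the pairs that occur, view [m] as a self-map of the [n] points, adding
    a point for undefined values if [m] is partial. Its iterates lose at least
    one point of the image in each of the first [i] steps, and on the image
    that remains [m] is a permutation of order [r] ([iter_eventual_perm]). So
    [r] is the order of a permutation of [n - i] points. A transformation has
    a nonempty eventual image, so [i < n]; for a partial bijection [i = n] is
    possible, with the empty permutation. All these pairs do occur: take a
    tail or a chain of [i] points and a permutation of order [r] on the other
    [n - i] points. Hence index [i] contributes [seq_s (n - i)] types ([seq_t_sum],
    [seq_i_sum]), and the two counts differ by the term [seq_s 0 = 1]. *)

Set Implicit Arguments.
Unset Strict Implicit.
Unset Printing Implicit Defensive.

Local Open Scope group_scope.

(** * Counting isomorphism types *)

(** The classes of [iso] are counted by any list [L] without repetition of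
    complete invariants. The invariant is a relation [cls] rather than a
    function because below it is read off from a generator, and a set can
    have many of them. *)
Lemma num_types_size (T : finType) (I : eqType) (iso : T -> T -> Prop)
    (P : T -> Prop) (cls : T -> I -> Prop) (L : seq I) :
    uniq L ->
    (forall A, P A -> exists2 v, v \in L & cls A v) ->
    (forall v, v \in L -> exists2 A, P A & cls A v) ->
    (forall A B v w, P A -> P B -> cls A v -> cls B w -> iso A B <-> v = w) ->
  num_types iso P = size L.
Proof.
move=> uL clsL repL isoE.
pose F A := [set B in [set C | `[< P C >]] | `[< iso A B >]].
have FE A B v w : P A -> P B -> cls A v -> cls B w -> F A = F B <-> v = w.
  move=> PA PB cA cB; split=> [eqF | eq_vw].
    have: B \in F A by rewrite eqF !inE !asboolT //; apply/(isoE B B w w).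
    by rewrite !inE => /andP[_ /asboolP /(isoE A B v w)]; apply.
  apply/setP=> C; rewrite !inE; case: asboolP => //= PC.
  have [u _ cC] := clsL C PC; apply: asbool_equiv_eq.
  apply: (iff_trans (isoE A C v u PA PC cA cC)).
  by rewrite eq_vw; apply: iff_sym; apply: isoE.
have [rep repP] : {rep : I -> {set T} & forall v, v \in L ->
    exists A, [/\ P A, cls A v & rep v = F A]}.
  apply: (choice (P := fun v X => v \in L ->
    exists A, [/\ P A, cls A v & X = F A])) => v.
  case: (boolP (v \in L)) => [/repL[A PA cA] | _].
    by exists (F A) => _; exists A.
  by exists set0.
have uR : uniq (map rep L).
  rewrite map_inj_in_uniq // => v w /repP[A [PA cA ->]] /repP[B [PB cB ->]].
  by move/FE; apply.
rewrite -(size_map rep) -(card_uniqP uR); apply: eq_card => X.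
apply/imsetP/mapP => [[A] | [v Lv ->]].
  rewrite inE => /asboolP PA ->; have [v Lv cA] := clsL A PA.
  exists v => //; have [B [PB cB ->]] := repP v Lv.
  exact: (FE A B v v _ _ _ _).2.
have [A [PA cA ->]] := repP v Lv; by exists A; rewrite ?inE //; apply/asboolP.
Qed.

(** * Orders of permutations *)

Definition perm_orders k : seq nat := undup [seq #[g] | g : 'S_k].

Lemma mem_perm_orders k r : r \in perm_orders k <-> exists g : 'S_k, #[g] = r.
Proof.
rewrite mem_undup; split=> [/mapP[g _ ->]|[g <-]]; first by exists g.
by apply/mapP; exists g; rewrite ?mem_enum.
Qed.

Lemma seq_s_perm_orders k : seq_s k = size (perm_orders k).
Proof.
apply: (@num_types_size _ _ _ _ (fun (G : {group 'S_k}) r => #|G| = r)).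
- exact: undup_uniq.
- move=> G /cyclicP[g eG]; exists #|G| => //; rewrite mem_perm_orders.
  by exists g; rewrite eG.
- move=> r /mem_perm_orders[g <-]; exists <[g]>%G => //; exact: cycle_cyclic.
move=> G H _ _ cG cH <- <-; rewrite isog_cyclic_card // cH /= eq_sym.
by split=> /eqP.
Qed.

(** The empty set has one permutation, which is why the pair of index [n] and
    period 1 accounts for exactly one type of monogenic inverse submonoid. *)
Lemma perm_orders0 : perm_orders 0 = [:: 1%N].
Proof.
have: perm_orders 0 =i [:: 1%N].
  move=> r; rewrite inE; apply/idP/eqP => [/mem_perm_orders[g <-]| ->].
    suff ->: g = 1 by rewrite order1.
    by apply/permP=> -[].
  by apply/mem_perm_orders; exists 1; rewrite order1.
by move=> E; apply: perm_small_eq => //; apply: uniq_perm; rewrite ?undup_uniq.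
Qed.

Lemma eq_order (gT rT : finGroupType) (x : gT) (y : rT) :
  (forall a, x ^+ a = 1 <-> y ^+ a = 1) -> #[x] = #[y].
Proof.
move=> E; apply/eqP; rewrite eqn_dvd !order_dvdn.
by apply/andP; split; apply/eqP/E; apply: expg_order.
Qed.

Lemma perm_onX (T : finType) (C : {set T}) (p : {perm T}) a :
  perm_on C p -> perm_on C (p ^+ a).
Proof.
by move=> pC; elim: a => [|a IH]; rewrite ?perm_on1 // expgS perm_onM.
Qed.

(** Only the number of points that a permutation may move limits its order: an
    injection of [C] into [D] carries [p] to a permutation [q] that fixes
    every point outside the image. *)
Lemma perm_on_transport (T T' : finType) (C : {set T}) (D : {set T'})
    (p : {perm T}) :
  perm_on C p -> #|C| <= #|D| ->
  exists2 q : {perm T'}, perm_on D q & #[q] = #[p].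
Proof.
move=> pC leCD; have [C0 | [x0 Cx0]] := set_0Vmem C.
  exists 1; first exact: perm_on1.
  suff ->: p = 1 by rewrite !order1.
  by apply/permP=> x; rewrite perm1 (out_perm pC) // C0 inE.
have /card_gt0P[y0 Dy0] : 0 < #|D|.
  by apply: leq_trans leCD; apply/card_gt0P; exists x0.
(* h matches C with the first #|C| elements of D. *)
pose h x := nth y0 (enum D) (index x (enum C)).
have ltC x : x \in C -> index x (enum C) < size (enum D).
  move=> Cx; rewrite -cardE (leq_trans _ leCD) // [#|C|]cardE.
  by rewrite index_mem mem_enum.
have hD x : x \in C -> h x \in D by move=> /ltC Cx; rewrite -mem_enum mem_nth.
have hI : {in C &, injective h}.
  move=> x y Cx Cy /eqP; rewrite nth_uniq ?ltC ?enum_uniq //.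
  move=> /eqP/(congr1 (nth x0 (enum C))).
  by rewrite !nth_index ?mem_enum.
pose g y := if [pick x in C | h x == y] is Some x then h (p x) else y.
have gh x : x \in C -> g (h x) = h (p x).
  move=> Cx; rewrite /g; case: pickP => [x' /andP[Cx' /eqP/hI->] //| /(_ x)].
  by rewrite Cx eqxx.
have gP y : (exists2 x, x \in C & y = h x) \/
    (forall x, x \in C -> h x <> y) /\ g y = y.
  rewrite /g; case: pickP => [x /andP[Cx /eqP<-]|noP]; first by left; exists x.
  by right; split=> // x Cx hx; have := noP x; rewrite Cx hx eqxx.
have pCx x : x \in C -> p x \in C by rewrite (perm_closed _ pC).
have gI : injective g.
  move=> y y'; have [[x Cx ->]|[ny ->]] := gP y;
    have [[x' Cx' ->]|[ny' ->]] := gP y'.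
  - by rewrite !gh // => /hI-/(_ (pCx _ Cx) (pCx _ Cx'))/perm_inj->.
  - by rewrite gh // => /ny'; case; apply: pCx.
  - by rewrite gh // => /esym/ny; case; apply: pCx.
  - by [].
pose q := perm gI; exists q.
  apply/subsetP=> y; rewrite inE permE; have [[x Cx ->] _|[_ ->]] := gP y.
    exact: hD.
  by rewrite eqxx.
have qX a x : x \in C -> (q ^+ a) (h x) = h ((p ^+ a) x).
  move=> Cx; have: (p ^+ a) x \in C by rewrite perm_closed // perm_onX.
  elim: a => [|a IH]; first by rewrite !perm1.
  rewrite !expgSr !permM => H; rewrite IH ?permE ?gh //.
  - by rewrite -(perm_closed _ pC).
  - by rewrite -(perm_closed _ pC).
apply: eq_order => a; split=> E; apply/permP=> x; rewrite perm1.
  case: (boolP (x \in C)) => Cx; last by rewrite (out_perm (S:=C)) // perm_onX.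
  by apply: hI => //; rewrite -?qX ?E ?perm1 // perm_closed // perm_onX.
have [[z Cz ->]|[nx gx]] := gP x; first by rewrite qX // E perm1.
by rewrite permX iter_fix // permE.
Qed.

Lemma perm_on_orders (T : finType) (C : {set T}) (p : {perm T}) k :
  perm_on C p -> #|C| <= k -> #[p] \in perm_orders k.
Proof.
move=> pC leCk; have [|q _ oq] := @perm_on_transport T 'I_k C setT p pC.
  by rewrite cardsT card_ord.
by apply/mem_perm_orders; exists q.
Qed.

Lemma card_ord_geq n i : #|[set x : 'I_n | i <= x]| = n - i.
Proof.
rewrite -sum1_card.
rewrite (eq_bigl (fun x : 'I_n => i <= x)) => [|x]; last by rewrite inE.
rewrite -(big_mkord (fun x => i <= x) (fun=> 1%N)).
elim: n => [|n IH]; first by rewrite big_nil.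
rewrite big_mkcond big_nat_recr //= -big_mkcond IH; case: ifP; lia.
Qed.

Lemma perm_orders_perm_on n i r : r \in perm_orders (n - i) ->
  exists2 q : 'S_n, perm_on [set x : 'I_n | i <= x] q & #[q] = r.
Proof.
case/mem_perm_orders=> g <-; apply: (@perm_on_transport _ _ setT).
  by apply/subsetP=> x; rewrite inE.
by rewrite card_ord_geq cardsT card_ord.
Qed.

(** The pairs of an index [i < b] and a period that [n - i] points can carry
    once a tail has used up [i] of the [n] available points. *)
Definition realizable_pairs n b : seq (nat * nat) :=
  [seq (i, r) | i <- iota 0 b, r <- perm_orders (n - i)].

Lemma mem_realizable_pairs n b i r :
  (i, r) \in realizable_pairs n b = (i < b) && (r \in perm_orders (n - i)).
Proof.
apply/allpairsPdep/andP => [[j [s [jb so [-> ->]]]]|[ib ro]].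
  by rewrite mem_iota in jb.
by exists i, r; rewrite mem_iota.
Qed.

Lemma uniq_realizable_pairs n b : uniq (realizable_pairs n b).
Proof.
apply: allpairs_uniq_dep => [|i _|]; [exact: iota_uniq | exact: undup_uniq |].
by move=> [i r] [j s] _ _ /= [-> ->].
Qed.

Lemma size_realizable_pairs n b :
  size (realizable_pairs n b) = \sum_(0 <= i < b) seq_s (n - i).
Proof.
rewrite size_allpairs_dep sumnE big_map /index_iota subn0.
by apply: eq_bigr => i _; rewrite seq_s_perm_orders.
Qed.

(** * Index and period *)

(** The powers of [m] are distinct up to [m ^+ i], and from there on they
    repeat with least period [r]. The last clause is the form in which
    minimality of both numbers is easiest to establish and to use;
    [expg_eq_index_period] gives the usual one. *)
Definition index_period (M : monoidType) (m : M) (i r : nat) : Prop :=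
  [/\ 0 < r, m ^+ (i + r) = m ^+ i
    & forall j q, 0 < q -> m ^+ (j + q) = m ^+ j -> i <= j /\ r %| q].

Lemma expg_period (M : monoidType) (m : M) i r a q :
  m ^+ (i + r) = m ^+ i -> i <= a -> r %| q -> m ^+ (a + q) = m ^+ a.
Proof.
move=> mi le_ia /dvdnP[t ->]; elim: t => [|t IH]; first by rewrite mul0n addn0.
rewrite mulSn addnA -{1}(subnK le_ia) -addnA -addnA expgnDr addnA expgnDr mi.
by rewrite -!expgnDr addnA subnK.
Qed.

(** Two exponents give the same power exactly when they are equal, or both lie
    in the periodic part and agree modulo the period. So the multiplication of
    the powers of [m] depends on [i] and [r] alone. *)
Lemma expg_eq_index_period (M : monoidType) (m : M) i r a b :
    index_period m i r ->
  m ^+ a = m ^+ b <-> a = b \/ [/\ i <= a, i <= b & a = b %[mod r]].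
Proof.
case=> r_gt0 mi minir; wlog le_ab : a b / a <= b => [wlg|].
  have [/wlg//|/ltnW/wlg W] := leqP a b.
  split=> [/esym/W [->|[? ? ->]]|[->|[? ? E]]]; [by left|by right|by []|].
  by apply/esym/W; right.
split=> [E | [->//|[le_ia le_ib E]]].
  have [lt_ab|] := ltnP a b; last by left; lia.
  have [||le_ia dvd] := minir a (b - a); rewrite ?subn_gt0 ?subnKC //.
  by right; split; [|lia|]; rewrite // -(subnKC le_ab) -modnDmr (eqP dvd) addn0.
rewrite -(subnKC le_ab) (expg_period mi) //.
by rewrite -eqn_mod_dvd // E.
Qed.

(** Any coincidence between powers suffices. For the least [i] from which some
    period works and the least period [r] at [i], every period [q] found
    elsewhere is also a period at [i], because adding a multiple of [r] to the
    exponent [i] does not change the power and leads past that place; then [q %% r]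
    is a period at [i] as well and must vanish. *)
Lemma index_period_exists (M : monoidType) (m : M) j0 q0 :
  0 < q0 -> m ^+ (j0 + q0) = m ^+ j0 -> exists i r, index_period m i r.
Proof.
move=> q0_gt0 mj0.
pose P j q := (0 < q) && (m ^+ (j + q) == m ^+ j).
have exi : exists j, `[< exists q, P j q >].
  by exists j0; apply/asboolP; exists q0; rewrite /P q0_gt0 mj0 eqxx.
case: (ex_minnP exi) => i /asboolP exr mini.
case: (ex_minnP exr) => r /andP[r_gt0 /eqP mi] minr.
exists i, r; split=> // j q q_gt0 mj.
have le_ij : i <= j.
  by apply: mini; apply/asboolP; exists q; rewrite /P q_gt0 mj eqxx.
split=> //; set s := q %% r.
have miq : m ^+ (i + q) = m ^+ i.
  have E1 := expg_period mi (leqnn i) (dvdn_mulr j (dvdnn r)).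
  have E2 := expg_period mi (leq_addr q i) (dvdn_mulr j (dvdnn r)).
  have le_j : j <= i + r * j by nia.
  rewrite -E2 -[RHS]E1 addnAC -(subnK le_j) -addnA.
  by rewrite expgnDr mj -expgnDr.
rewrite /dvdn; apply: contraT; rewrite -lt0n => s_gt0.
have /minr : P i s.
  rewrite /P s_gt0 -(expg_period mi (leq_addr s i) (dvdn_mull (q %/ r) (dvdnn r))).
  by rewrite -addnA [s + _]addnC -divn_eq miq eqxx.
by rewrite leqNgt ltn_pmod.
Qed.

Lemma pigeonhole_nat (T : finType) (g : nat -> T) :
  exists j q, 0 < q /\ g (j + q) = g j.
Proof.
have /injectivePn[a [b]] : ~~ injectiveb (fun k : 'I_#|T|.+1 => g k).
  apply/injectiveP => /leq_card; rewrite card_ord; lia.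
wlog lt_ab : a b / a < b => [wlg|_ E].
  move=> ne E; case: (ltngtP a b) => [/wlg|/wlg|/val_inj ab]; [exact| |].
    by apply; rewrite 1?eq_sym.
  by rewrite ab eqxx in ne.
by exists a, (b - a); rewrite subn_gt0 subnKC // ltnW.
Qed.

(** Two images of one structure [W] of expressions are isomorphic when the
    same pairs of expressions become equal in both. *)
Lemma monoid_iso_of_kernel (M N : monoidType) (W : Type) (u : W)
    (op : W -> W -> W) (e : W -> M) (e' : W -> N)
    (A : {pred M}) (B : {pred N}) :
    e u = 1 -> e' u = 1 ->
    (forall v w, e (op v w) = e v * e w) ->
    (forall v w, e' (op v w) = e' v * e' w) ->
    (forall v w, e v = e w <-> e' v = e' w) ->
    (forall x, x \in A <-> exists w, x = e w) ->
    (forall y, y \in B <-> exists w, y = e' w) ->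
  monoid_iso A B.
Proof.
move=> eu eu' eM eM' ker genA genB.
pose f x := if pselect (exists w, x = e w) is left ex then e' (projT1 (cid ex))
            else 1.
have fe w : f (e w) = e' w.
  rewrite /f; case: pselect => [ex|[]]; last by exists w.
  by case: (cid ex) => v /= /esym/ker.
exists f; split.
- by rewrite -eu fe.
- by move=> x y /genA[v ->] /genA[w ->]; rewrite -eM !fe eM'.
- by move=> x y /genA[v ->] /genA[w ->]; rewrite !fe => /ker.
move=> y; split=> [/genB[w ->]|[x /genA[w ->] ->]]; last by rewrite fe; apply/genB; exists w.
by exists (e w); rewrite ?fe //; apply/genA; exists w.
Qed.

(** The law [x ^+ (i + r) = x ^+ i] passes through an isomorphism, and the
    minimality of the index and period of the element on the other side then
    bounds them by [i] and [r]. An isomorphism need not send generators to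
    chosen generators, which is why the law has to hold throughout [A] and
    [B]. *)
Lemma monoid_iso_index_period (M N : monoidType) (A : {pred M}) (B : {pred N})
    m m' i r i' r' :
    submonoid A -> submonoid B ->
    m \in A -> m' \in B ->
    index_period m i r -> index_period m' i' r' ->
    {in A, forall x, x ^+ (i + r) = x ^+ i} ->
    {in B, forall y, y ^+ (i' + r') = y ^+ i'} ->
  monoid_iso A B -> i = i' /\ r = r'.
Proof.
move=> [A1 AM] [B1 BM] Am Bm' [r_gt0 _ minm] [r'_gt0 _ minm'] expA expB.
case=> f [f1 fM fI fB].
have AX x a : x \in A -> x ^+ a \in A.
  by move=> Ax; elim: a => // a IH; rewrite expgS AM.
have fX x a : x \in A -> f (x ^+ a) = f x ^+ a.
  by move=> Ax; elim: a => // a IH; rewrite !expgS fM ?AX ?IH.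
have [|le_i dvd_r] := minm i' r' r'_gt0.
  apply: fI; rewrite ?AX // !fX // expB //.
  by apply/fB; exists m.
have /fB[x Ax m'x] := Bm'.
have [|le_i' dvd_r'] := minm' i r r_gt0.
  by rewrite m'x -!fX // expA.
by split; apply/eqP; [rewrite eqn_leq le_i | rewrite eqn_dvd dvd_r].
Qed.

(** The images of the iterates of [f] decrease strictly for [i] steps, since
    one equality would make all later images equal and so make [f] periodic
    too early; each of these steps loses at least one point. On the last image
    [f] is a permutation, whose order is the period of [f]. *)
Lemma iter_eventual_perm (T : finType) (f : T -> T) i r :
    0 < r -> (forall x, iter (i + r) f x = iter i f x) ->
    (forall j q, 0 < q -> (forall x, iter (j + q) f x = iter j f x) ->
       i <= j /\ r %| q) ->
  exists p : {perm T},
    let C := [set iter i f x | x in T] in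
    [/\ perm_on C p, {in C, p =1 f}, #[p] = r & #|C| + i <= #|T|].
Proof.
move=> r_gt0 fir minf; pose C j := [set iter j f x | x in T].
have CS j : C j.+1 = f @: C j.
  apply/setP=> y; apply/imsetP/imsetP => [[x _ ->]|[_ /imsetP[x _ ->] ->]].
    by exists (iter j f x); rewrite ?imset_f.
  by exists x.
have Cr x : x \in C i -> iter r f x = x.
  by case/imsetP=> y _ ->; rewrite -iterD addnC fir.
have CX x a : x \in C i -> iter a f x \in C i.
  by case/imsetP=> y _ ->; rewrite -iterD addnC iterD; apply: imset_f.
have fI : {in C i &, injective f}.
  move=> x y Cx Cy fxy; rewrite -(Cr x) // -(Cr y) //.
  by rewrite -(prednK r_gt0) !iterSr fxy.
pose g x := if x \in C i then f x else x.
have gI : injective g.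
  have fC x : x \in C i -> f x \in C i by move=> Cx; apply: (CX x 1%N Cx).
  move=> x y; rewrite /g; case: ifPn => Cx; case: ifPn => Cy //; first exact: fI.
    by move=> E; rewrite -E fC in Cy.
  by move=> E; rewrite E fC in Cx.
pose p := perm gI; exists p => /=; rewrite -/(C i).
have pC : perm_on (C i) p.
  by apply/subsetP=> x; rewrite inE permE /g; case: ifP => // _; rewrite eqxx.
have pf : {in C i, p =1 f} by move=> x Cx; rewrite permE /g Cx.
have pX a x : x \in C i -> (p ^+ a) x = iter a f x.
  move=> Cx; rewrite permX; elim: a => //= a ->; exact/pf/CX.
split=> //.
  apply/eqP; rewrite eqn_dvd order_dvdn; apply/andP; split.
    apply/eqP/permP=> x; rewrite perm1.
    have [Cx|Cx] := boolP (x \in C i); first by rewrite pX // Cr.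
    by rewrite (out_perm (perm_onX _ pC)).
  apply: (minf i _ _ _).2; first exact: order_gt0.
  move=> x; rewrite addnC iterD -pX ?expg_order ?perm1 //; exact: imset_f.
suff bound j : j <= i -> #|C j| + j <= #|T| by apply: bound.
elim: j => [_|j IH lt_ji]; first by rewrite addn0 max_card.
suff: #|C j.+1| < #|C j| by have := IH (ltnW lt_ji); lia.
(* If C j.+1 = C j then C j = C i, on which iter r f is the identity. *)
apply: proper_card; rewrite properEneq; apply/andP; split.
  apply/eqP=> eqC; suff [] : i <= j /\ r %| r by lia.
  have eqCi k : C (k + j) = C j.
    by elim: k => // k IHk; rewrite addSn CS IHk -CS.
  apply: minf => // x; rewrite addnC iterD Cr //.
  by rewrite -(subnK (ltnW lt_ji)) eqCi; apply: imset_f.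
by apply/subsetP=> _ /imsetP[x _ ->]; rewrite iterSr imset_f.
Qed.

(** * Monogenic submonoids of the full transformation monoid *)

Lemma transfX n (m : transf n) a x : (m ^+ a : transf n) x = iter a m x.
Proof.
elim: a x => [|a IH] x; first by rewrite ffunE.
by rewrite expgSr ffunE IH.
Qed.

Lemma transfX_eq n (m : transf n) a b :
  m ^+ a = m ^+ b <-> forall x, iter a m x = iter b m x.
Proof.
split=> [E x | E]; first by rewrite -!transfX E.
by apply/ffunP => x; rewrite !transfX.
Qed.

(** The eventual image is nonempty, hence the strict inequality: this is where
    transformations and partial bijections differ. *)
Lemma index_period_transf n (m : transf n) i r : 0 < n ->
  index_period m i r -> i < n /\ r \in perm_orders (n - i).
Proof.
move=> n_gt0 [r_gt0 /transfX_eq mi minm].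
have [|p [pC _ <- cardC]] := iter_eventual_perm r_gt0 mi.
  by move=> j q q_gt0 /transfX_eq; apply: minm.
move: pC cardC; set C := [set _ | _ in _] => pC; rewrite card_ord => cardC; split.
  have : 0 < #|C|.
    by apply/card_gt0P; exists (iter i m (Ordinal n_gt0)); apply: imset_f.
  lia.
by apply: perm_on_orders pC _; lia.
Qed.

(** The points below [i] form a tail [0, 1, ..., i - 1] that runs into the
    point [i], and the points from [i] on are permuted by [q]. *)
Lemma transf_index_period n i r : i < n -> r \in perm_orders (n - i) ->
  exists m : transf n, index_period m i r.
Proof.
case: n => // n lt_in /perm_orders_perm_on[q qD oq].
pose m : transf n.+1 := [ffun x : 'I_n.+1 => if x < i then inord x.+1 else q x].
have mq a (x : 'I_n.+1) : i <= x -> iter a m x = (q ^+ a) x.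
  move=> le_ix; rewrite permX; elim: a => //= a ->; rewrite ffunE -permX ltnNge.
  suff -> : i <= (q ^+ a) x by [].
  by have := perm_closed x (perm_onX a qD); rewrite !inE le_ix.
have m_lt a (x : 'I_n.+1) : x + a <= i -> iter a m x = x + a :> nat.
  elim: a => [|a IH] le_xa; first by rewrite addn0.
  rewrite /= ffunE IH; last by lia.
  have -> : x + a < i by lia.
  by rewrite inordK; lia.
have m_ge a (x : 'I_n.+1) : i <= x + a -> i <= iter a m x.
  move=> le_i; have [le_ix|lt_xi] := leqP i x.
    rewrite mq //; have := perm_closed x (perm_onX a qD); by rewrite !inE le_ix.
  have -> : a = (a - (i - x)) + (i - x) by lia.
  have e : iter (i - x) m x = i :> nat by rewrite m_lt; lia.
  rewrite iterD mq ?e //.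
  have := perm_closed (iter (i - x) m x) (perm_onX (a - (i - x)) qD).
  by rewrite !inE e leqnn.
exists m; split; first by rewrite -oq order_gt0.
  apply/transfX_eq => x; rewrite addnC iterD mq; last by apply: m_ge; lia.
  by rewrite -oq expg_order perm1.
move=> j k k_gt0 /transfX_eq E; split.
  rewrite leqNgt; apply/negP=> lt_ji; have := congr1 val (E ord0) => /=.
  rewrite (m_lt j) //=; last by lia.
  have [le_jk|lt_jk] := leqP (j + k) i; first by rewrite m_lt //=; lia.
  have := @m_ge (j + k) ord0; rewrite /= add0n => /(_ (ltnW lt_jk)); lia.
rewrite -oq order_dvdn; apply/eqP; apply: (mulgI (q ^+ j)).
rewrite mulg1 -expgD; apply/permP=> x.
have [le_ix|lt_xi] := leqP i x; first by rewrite -!mq.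
by rewrite !(out_perm (perm_onX _ qD)) // inE -ltnNge.
Qed.

Definition transf_type n (A : {set transf n}) (v : nat * nat) : Prop :=
  exists2 m, forall x, x \in A <-> exists j, x = m ^+ j
    & index_period m v.1 v.2.

Lemma seq_t_sum n : 0 < n -> seq_t n = \sum_(0 <= i < n) seq_s (n - i).
Proof.
move=> n_gt0; rewrite -size_realizable_pairs.
apply: (@num_types_size _ _ _ _ (@transf_type n)); first exact: uniq_realizable_pairs.
- move=> A [_ [m genA]]; have [j [q [q_gt0 mj]]] := pigeonhole_nat (fun j => m ^+ j).
  have [i [r mir]] := index_period_exists q_gt0 mj.
  exists (i, r); last by exists m.
  by have [lt_in ro] := index_period_transf n_gt0 mir; rewrite mem_realizable_pairs lt_in.
- case=> i r; rewrite mem_realizable_pairs => /andP[lt_in ro].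
  have [m mir] := transf_index_period lt_in ro.
  pose A : {set transf n} := [set x | `[< exists j, x = m ^+ j >]].
  have genA x : x \in A <-> exists j, x = m ^+ j.
    by rewrite inE; split=> /asboolP.
  exists A; last by exists m.
  split; last by exists m.
  split; first by apply/genA; exists 0.
  by move=> _ _ /genA[a ->] /genA[b ->]; apply/genA; exists (a + b); rewrite expgD.
move=> A B [i r] [j s] [subA _] [subB _] [m genA mir] [m' genB mjs] /=.
(* The exponent 0 has to be set apart: the identity satisfies every law, but
   [i * 0] does not reach the index. *)
have exp (C : {set transf n}) c k t :
    (forall x, x \in C <-> exists a, x = c ^+ a) -> index_period c k t ->
    {in C, forall x, x ^+ (k + t) = x ^+ k}.
  move=> genC ckt _ /genC[[|a] ->]; first by rewrite !expg1n.
  rewrite -!expgM; apply/(expg_eq_index_period _ _ ckt); right.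
  by split; [nia | nia | rewrite mulnDr -modnDmr modnMl addn0].
split=> [isoAB | [eij ers]].
  suff [-> ->] : i = j /\ r = s by [].
  apply: (monoid_iso_index_period subA subB _ _ mir mjs _ _ isoAB).
  - by apply/genA; exists 1%N.
  - by apply/genB; exists 1%N.
  - exact: exp mir.
  - exact: exp mjs.
rewrite -eij -ers in mjs.
apply: (monoid_iso_of_kernel _ _ _ _ _ genA genB (u := 0) (op := addn)) => //.
- by move=> a b; rewrite expgD.
- by move=> a b; rewrite expgD.
move=> a b; apply: (iff_trans (expg_eq_index_period a b mir)).
by apply: iff_sym; apply: expg_eq_index_period.
Qed.

(** * Index and period of partial bijections *)

(** A partial bijection as a self-map of ['I_n] with an added point [None]
    that stands for undefined and is fixed. This turns composition of
    relations into composition of maps, so that iterates can be treated as for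
    transformations. *)
Definition pact n (m : pbij n) (o : option 'I_n) : option 'I_n :=
  obind (fun x => [pick y | (x, y) \in graph m]) o.

Arguments pact : simpl never.

Lemma pactP n (m : pbij n) x y : pact m (Some x) = Some y <-> (x, y) \in graph m.
Proof.
rewrite /pact /=; split=> [|xy]; first by case: pickP => // z xz [<-].
case: pickP => [z xz|/(_ y)]; last by rewrite xy.
by have /esym := pbijP xy xz; rewrite eqxx => /eqP->.
Qed.

Lemma pact_inj n (m m' : pbij n) : pact m =1 pact m' -> m = m'.
Proof.
move=> E; apply/val_inj/setP=> -[x y] /=.
by apply/idP/idP => /pactP xy; apply/pactP; rewrite ?E // -E.
Qed.

Lemma pact1 n o : pact (1 : pbij n) o = o.
Proof. by case: o => // x; apply/pactP; rewrite inE. Qed.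

Lemma pactV n (m : pbij n) x y :
  pact m^-1 (Some y) = Some x <-> pact m (Some x) = Some y.
Proof.
by split=> /pactP xy; apply/pactP; move: xy; rewrite inE.
Qed.

Lemma option_eqP T (o o' : option T) :
  (forall y, o = Some y <-> o' = Some y) -> o = o'.
Proof. by case: o => [x|] E; [apply/esym/E | case: o' E => // y /(_ y)[_ ->]]. Qed.

Lemma pactM n (m m' : pbij n) o : pact (m * m') o = pact m' (pact m o).
Proof.
case: o => [x|] //; apply: option_eqP => y; split=> [/pactP|].
  by rewrite inE /= => /existsP[z /andP[/pactP-> /pactP]].
case E: (pact m (Some x)) => [z|] // /pactP zy; apply/pactP; rewrite inE /=.
by apply/existsP; exists z; rewrite zy andbT; apply/pactP.
Qed.

Lemma pactX n (m : pbij n) a o : pact (m ^+ a) o = iter a (pact m) o.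
Proof. by elim: a => [|a IH]; rewrite ?pact1 // expgSr pactM IH. Qed.

Lemma pactX_eq n (m : pbij n) a b :
  m ^+ a = m ^+ b <-> forall o, iter a (pact m) o = iter b (pact m) o.
Proof.
by split=> [E o | E]; [rewrite -!pactX E | apply: pact_inj => o; rewrite !pactX].
Qed.

Lemma pact_cancel n (m : pbij n) o o' x :
  pact m o = Some x -> pact m o' = Some x -> o = o'.
Proof. by case: o o' => [y|] [y'|] // /pactV + /pactV => -> ->. Qed.

Lemma iter_pactN n (m : pbij n) a : iter a (pact m) None = None.
Proof. by elim: a => //= a ->. Qed.

(** Among the [n.+1] points of [option 'I_n] the point [None] is a fixed point
    of the eventual permutation, so the permutation moves at most [n - i]
    points. It may move none at all, and then [i] may be equal to [n]. *)
Lemma index_period_pbij n (m : pbij n) i r :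
  index_period m i r -> i <= n /\ r \in perm_orders (n - i).
Proof.
move=> [r_gt0 /pactX_eq mi minm].
have [|p [pC pm <- cardC]] := iter_eventual_perm r_gt0 mi.
  by move=> j q q_gt0 /pactX_eq; apply: minm.
move: pC pm cardC; set C := [set _ | _ in _] => pC pm.
have CN : None \in C by rewrite -(iter_pactN m i); apply: imset_f.
rewrite card_option card_ord (cardsD1 None) CN => cardC; split; first by lia.
have pC' : perm_on (C :\ None) p.
  apply/subsetP=> o po; rewrite in_setD1 (subsetP pC) // andbT.
  by apply: contraTneq po => ->; rewrite inE pm // eqxx.
by apply: perm_on_orders pC' _; lia.
Qed.

Lemma pbij_of_fun n (phi : 'I_n -> option 'I_n) :
    (forall x x' y, phi x = Some y -> phi x' = Some y -> x = x') ->
  exists m : pbij n, forall x, pact m (Some x) = phi x.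
Proof.
move=> phiI; pose g := [set p | phi p.1 == Some p.2].
have gP : partial_bijection g.
  apply/forall_inP=> -[x y]; rewrite inE /= => /eqP xy.
  apply/forall_inP=> -[x' y']; rewrite inE /= => /eqP xy'.
  apply/eqP; apply/eqP/eqP=> E; first by move: xy'; rewrite -E xy => -[].
  by apply: phiI xy _; rewrite E.
exists (PBij gP) => x; apply: option_eqP => y.
by split=> [/pactP|] => [|E]; [rewrite inE => /eqP | apply/pactP; rewrite inE E].
Qed.

(** The points below [i] form a chain [0, 1, ..., i - 1] that stops, and the
    points from [i] on are permuted by [q]. *)
Lemma pbij_index_period n i r : i <= n -> r \in perm_orders (n - i) ->
  exists m : pbij n, index_period m i r.
Proof.
move=> le_in /perm_orders_perm_on[q qD oq].
have qi (x : 'I_n) : (i <= q x) = (i <= x).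
  by have := perm_closed x qD; rewrite !inE.
pose phi (x : 'I_n) : option 'I_n :=
  if x < i then (if x.+1 < i then insub x.+1 else None) else Some (q x).
have phi_lt (x y : 'I_n) : x < i -> phi x = Some y -> y = x.+1 :> nat /\ y < i.
  rewrite /phi => ->; case: ifP => // lt_xi.
  by case: insubP => // u _ /= eu [<-]; rewrite eu.
have phi_ge (x : 'I_n) : i <= x -> phi x = Some (q x) by rewrite /phi ltnNge => ->.
have [x x' y xy x'y|m mE] := @pbij_of_fun n phi.
  have [le_ix|lt_xi] := leqP i x; have [le_ix'|lt_xi'] := leqP i x'.
  - by move: xy x'y; rewrite !phi_ge // => -[<-] [/perm_inj].
  - have [_] := phi_lt _ _ lt_xi' x'y.
    by move: xy; rewrite phi_ge // => -[<-]; rewrite ltnNge qi le_ix.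
  - have [_] := phi_lt _ _ lt_xi xy.
    by move: x'y; rewrite phi_ge // => -[<-]; rewrite ltnNge qi le_ix'.
  have [e _] := phi_lt _ _ lt_xi xy; have [e' _] := phi_lt _ _ lt_xi' x'y.
  by apply: val_inj; move: e'; rewrite e => -[].
have mq a (x : 'I_n) : i <= x -> iter a (pact m) (Some x) = Some ((q ^+ a) x).
  move=> le_ix; elim: a => [|a IH]; first by rewrite perm1.
  rewrite /= IH mE phi_ge ?expgSr ?permM //.
  by have := perm_closed x (perm_onX a qD); rewrite !inE le_ix.
have m_lt a (x : 'I_n) : x < i -> 
    omap val (iter a (pact m) (Some x)) = if x + a < i then Some (x + a) else None.
  move=> lt_xi; elim: a => [|a]; first by rewrite addn0 lt_xi.
  rewrite /=; case: (iter a _ _) => [y|]; last first.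
    by rewrite addnS /=; case: ltnP => // le _; rewrite ltnNge leqW.
  case: ifP => // lt_xa [ey]; rewrite mE /phi ey lt_xa addnS.
  by case: ifP => // lt_xa'; rewrite insubT //=; lia.
have iN (x : 'I_n) : x < i -> iter i (pact m) (Some x) = None.
  by move=> /(m_lt i); rewrite ltnNge leq_addl; case: (iter _ _ _).
exists m; split; first by rewrite -oq order_gt0.
  apply/pactX_eq => -[x|]; last by rewrite !iter_pactN.
  have [le_ix|lt_xi] := leqP i x; last by rewrite addnC iterD iN ?iter_pactN.
  by rewrite !mq // expgD -oq expg_order mulg1.
move=> j k k_gt0 /pactX_eq E; split.
  rewrite leqNgt; apply/negP=> lt_ji.
  have n_gt0 : 0 < n by lia.
  have := congr1 (omap val) (E (Some (Ordinal n_gt0))).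
  have i_gt0 : 0 < i by lia.
  by rewrite !m_lt //= !add0n lt_ji; case: ifP => // _ []; lia.
rewrite -oq order_dvdn; apply/eqP; apply: (mulgI (q ^+ j)).
rewrite mulg1 -expgD; apply/permP=> x.
have [le_ix|lt_xi] := leqP i x; first by apply: Some_inj; rewrite -!mq.
by rewrite !(out_perm (perm_onX _ qD)) // inE -ltnNge.
Qed.

(** * Words in an element and its inverse *)

Definition letter (M : starMonoidType) (m : M) (b : bool) : M :=
  if b then m else m^-1.

Fixpoint word (M : starMonoidType) (m : M) (w : seq bool) : M :=
  if w is b :: w' then letter m b * word m w' else 1.

Lemma word_cat (M : starMonoidType) (m : M) v w :
  word m (v ++ w) = word m v * word m w.
Proof. by elim: v => [|b v IH] /=; rewrite ?mul1g // IH mulgA. Qed.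

Lemma wordV (M : starMonoidType) (m : M) w :
  (word m w)^-1 = word m (rev (map negb w)).
Proof.
elim: w => [|b w IH] /=; first by rewrite invg1.
rewrite invgM IH rev_cons -cats1 word_cat /= mulg1.
by case: b; rewrite /letter /= ?invgK.
Qed.

Lemma submonoid_generated_wordP (M : starMonoidType) (m : M) (A : {pred M}) :
  submonoid_generated_by (pred2 m m^-1) A <->
  (forall x, x \in A <-> exists w, x = word m w).
Proof.
pose W : {pred M} := [pred x | `[< exists w, x = word m w >]].
have inW x : x \in W <-> exists w, x = word m w.
  by rewrite inE; split=> /asboolP.
have gen x : (forall B : {pred M}, submonoid B ->
    {subset pred2 m m^-1 <= B} -> x \in B) <-> exists w, x = word m w.
  split=> [H | [w ->] B [B1 BM] sB].
    apply/inW; apply: H => [|y].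
      split; first by apply/inW; exists [::].
      by move=> _ _ /inW[v ->] /inW[w ->]; apply/inW; exists (v ++ w); rewrite word_cat.
    by rewrite inE => /orP[] /eqP->; apply/inW; [exists [:: true] | exists [:: false]];
      rewrite /= mulg1.
  elim: w => //= b w IH; apply: BM => //; apply: sB.
  by case: b; rewrite inE eqxx ?orbT.
split=> H x; first exact: iff_trans (H x) (gen x).
exact: iff_trans (H x) (iff_sym (gen x)).
Qed.

(** The effect of a word on a chain with points [0, ..., l - 1], along which
    the generator moves one step up: [Some k] if the walk from [j] stays on
    the chain and ends in [k], and [None] if it leaves the chain. *)
Fixpoint walk (l : nat) (w : seq bool) (j : nat) : option nat :=
  match w with
  | [::] => Some j
  | true :: w' => if j.+1 < l then walk l w' j.+1 else None
  | false :: w' => if j is j'.+1 then walk l w' j' else None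
  end.

(** A walk from [j] stays in [0, l) exactly when, on the longer chain, the
    walks from [j] and from [j + d] both stay: the first one sees the lower
    end and the second one sees the upper end. So the action of a word on a
    chain determines its action on all shorter chains. *)
Lemma walk_shrink l d w j : j < l ->
  walk l w j = if walk (l + d) w (j + d) then walk (l + d) w j else None.
Proof.
elim: w j => [|[] w IH] j lt_jl //=.
  rewrite -addSn ltn_add2r; case: ltnP => // lt_jl'.
  by rewrite (leq_trans lt_jl') ?leq_addr // IH.
case: j lt_jl => [|j] lt_jl; last by rewrite addSn IH // ltnW.
by case: (0 + d)%N => // d'; case: (walk _ _ _).
Qed.

Lemma walk_lt l w j k : j < l -> walk l w j = Some k -> k < l.
Proof.
elim: w j => [|[] w IH] j lt_jl /=; first by case=> <-.
  by case: ifP => // lt_jl' /IH; apply.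
by case: j lt_jl => // j lt_jl /IH; apply; apply: ltnW.
Qed.

Lemma walk_shift l w j k :
  walk l w j = Some k -> k + count negb w = j + count id w.
Proof.
elim: w j => [|[] w IH] j /=; first by case=> ->; lia.
  by case: ifP => // _ /IH; lia.
by case: j => // j /IH; lia.
Qed.

Lemma walk_cat l v w j : walk l (v ++ w) j = obind (walk l w) (walk l v j).
Proof.
elim: v j => [|[] v IH] j //=; first by case: ifP.
by case: j.
Qed.

Definition wpow (w : seq bool) a := flatten (nseq a w).

Lemma word_wpow (M : starMonoidType) (m : M) w a :
  word m (wpow w a) = word m w ^+ a.
Proof. by elim: a => //= a IH; rewrite /wpow /= word_cat IH expgS. Qed.

Lemma count_wpow p w a : count p (wpow w a) = (a * count p w)%N.
Proof. by rewrite count_flatten map_nseq sumn_nseq mulnC. Qed.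

(** If a word has as many letters of either kind, it acts as a partial
    identity and so do all its positive powers. Otherwise every application
    moves a point at least one step in a fixed direction, and [l] of them
    leave the chain. *)
Lemma walk_wpow_stable l w j a b : j < l -> l <= a -> l <= b ->
  walk l (wpow w a) j = walk l (wpow w b) j.
Proof.
move=> lt_jl le_la le_lb; have [eqc | nec] := eqVneq (count id w) (count negb w).
  have stable c : 0 < c -> walk l (wpow w c) j = walk l w j.
    case: c => // c _; elim: c => [|c IH]; first by rewrite /wpow /= cats0.
    rewrite /wpow /= -/(wpow w c.+1) walk_cat; case E: (walk l w j) => [k|] //=.
    have ekj : k = j by have := walk_shift E; lia.
    by rewrite ekj in E *; rewrite IH E.
  by rewrite !stable //; lia.
have none c : l <= c -> walk l (wpow w c) j = None.
  move=> le_lc; case E: (walk _ _ _) => [k|] //.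
  have := walk_lt lt_jl E; have := walk_shift E; rewrite !count_wpow.
  by move: nec; nia.
by rewrite !none.
Qed.

(** On points of period [r] the inverse acts as the power [r.-1], so a word
    acts there as a power with a natural number as exponent. *)
Definition net_shift r (w : seq bool) := sumn [seq if b then 1%N else r.-1 | b <- w].

Lemma net_shift_wpow r w a : net_shift r (wpow w a) = (a * net_shift r w)%N.
Proof.
elim: a => //= a IH; rewrite /wpow /= -/(wpow w a) /net_shift map_cat sumn_cat.
by rewrite -!/(net_shift r _) IH.
Qed.

(** * Cycles and chains of a partial bijection *)

Section Trajectories.
Variables (n : nat) (m : pbij n).
Local Notation f := (pact m).

Lemma pact_wordS b w o :
  pact (word m (b :: w)) o = pact (word m w) (pact (letter m b) o).
Proof. by rewrite /= pactM. Qed.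

Lemma iter_pact_cancel a o o' x :
  iter a f o = Some x -> iter a f o' = Some x -> o = o'.
Proof.
elim: a x => [|a IH] x /=; first by move=> -> ->.
case E: (iter a f o) => [y|] // yx; case E': (iter a f o') => [y'|] // y'x.
have [eqy] := pact_cancel yx y'x; by apply: IH E _; rewrite E' eqy.
Qed.

Lemma iter_pactV a x y :
  iter a (pact m^-1) (Some x) = Some y -> iter a f (Some y) = Some x.
Proof.
elim: a y => [|a IH] y /=; first by case=> ->.
case E: (iter a _ _) => [z|] // /pactV zy.
by rewrite -iterS iterSr zy; apply: IH.
Qed.

Lemma pact_word_periodic r w o : 0 < r -> iter r f o = o ->
  pact (word m w) o = iter (net_shift r w) f o.
Proof.
move=> r_gt0; elim: w o => [|b w IH] o per; first exact: pact1.
have -> : net_shift r (b :: w) = (net_shift r w + if b then 1%N else r.-1)%N.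
  by rewrite addnC.
rewrite pact_wordS iterD -IH; last first.
  by rewrite -iterD addnC iterD per.
congr (pact _ _); case: b => //=; case: o per => [x|_]; last by rewrite iter_pactN.
rewrite -{1}(prednK r_gt0) iterS; case: (iter _ _ _) => [y|] //.
by rewrite /letter => /pactV.
Qed.

(** The trajectory of [z] is a maximal chain with [l] points. *)
Definition chain l z := [/\ pact m^-1 (Some z) = None, iter l f (Some z) = None
  & forall j, j < l -> iter j f (Some z) <> None].

Lemma pact_word_chain l z w j : chain l z -> j < l ->
  pact (word m w) (iter j f (Some z)) =
    oapp (fun k => iter k f (Some z)) None (walk l w j).
Proof.
case=> zN lN jS; elim: w j => [|[] w IH] j lt_jl; first exact: pact1.
  rewrite pact_wordS /= -iterS; case: ltnP => [|le_lj]; first exact: IH.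
  have -> : j.+1 = l by lia.
  by rewrite lN.
rewrite pact_wordS /=; case: j lt_jl => [|j] lt_jl; first by rewrite /= zN.
rewrite -IH; last exact: ltnW.
have /= := jS j.+1 lt_jl; case E: (iter j f _) => [x|] //.
by case Ex: (pact m (Some x)) => [y|] // _; move/pactV: Ex => ->.
Qed.

Lemma chain_inj l z j k : chain l z -> j < l -> k < l ->
  iter j f (Some z) = iter k f (Some z) -> j = k.
Proof.
case=> zN _ jS; wlog le_jk : j k / j <= k => [wlg|lt_jl lt_kl].
  by have [/wlg//|/ltnW/wlg W] := leqP j k; move=> lj lk /esym/(W lk lj).
rewrite -(subnKC le_jk) iterD; case: (k - j) => [|d]; first by rewrite addn0.
case E: (iter j f (Some z)) => [x|]; last by case: (jS j).
move/esym=> E'; have /esym := iter_pact_cancel E E'.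
rewrite iterS; case: (iter d _ _) => [y|] // /pactV.
by rewrite zN.
Qed.

Variables (i r : nat).
Hypothesis mir : index_period m i r.

(** A point and its [r]-th iterate have the same [i]-th iterate, and [m] can
    be cancelled as long as the value is defined. *)
Lemma pact_periodic o : iter i f o <> None -> iter r f o = o.
Proof.
case: mir => _ /pactX_eq/(_ o) mi _; case E: (iter i f o) => [x|] // _.
by apply/esym/(iter_pact_cancel E); rewrite -iterD mi.
Qed.

(** Some chain has exactly [i] points: a point [z] that witnesses the
    minimality of [i] cannot be periodic, so it has [i - 1] successors and no
    more, and a predecessor of [z] would have [i] successors, so it would be
    periodic and [z] too. *)
Lemma chain_index : 0 < i -> exists z, chain i z.
Proof.
case: (mir) => r_gt0 _ minm i_gt0.
have /existsNP[[z|]] : ~ forall o, iter (i.-1 + r) f o = iter i.-1 f o.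
- by move/pactX_eq/minm => /(_ r_gt0)[]; lia.
- move=> nper.
  have npz : iter r f (Some z) <> Some z by move=> E; apply: nper; rewrite iterD E.
  have zi : iter i f (Some z) = None.
    by apply: contrapT => /pact_periodic.
  have zS j : j < i -> iter j f (Some z) <> None.
    move=> lt_ji E; apply: nper.
    have -> : i.-1 = ((i.-1 - j) + j)%N by lia.
    by rewrite [RHS]iterD E addnC !iterD -iterD addnC iterD E !iter_pactN.
  exists z; split=> //; case E: (pact m^-1 (Some z)) => [y|] //.
  move/pactV: E => yz; case: npz; rewrite -yz -iterSr iterS pact_periodic //.
  by rewrite -(prednK i_gt0) iterSr yz; apply: zS; rewrite prednK.
by rewrite !iter_pactN.
Qed.

(** Going backwards from a point that is not periodic ends at the start of a
    chain, and no chain has more than [i] points. *)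
Lemma periodic_or_chain x : iter r f (Some x) = Some x \/
  exists l z j, [/\ l <= i, j < l, chain l z & iter j f (Some z) = Some x].
Proof.
have [per|nper] := pselect (iter r f (Some x) = Some x); [by left|right].
have nper_back b z : iter b f (Some z) = Some x -> iter i f (Some z) = None.
  move=> zx; apply: contrapT => /pact_periodic perz; apply: nper.
  by rewrite -zx -iterD addnC iterD perz.
have exb : exists b, iter b (pact m^-1) (Some x) == None.
  exists i; case E: (iter i _ _) => [y|] //.
  by have := iter_pactV E; have := nper_back i y (iter_pactV E); move=> ->.
case: (ex_minnP exb) => -[|b] // /eqP bN minb.
case E: (iter b (pact m^-1) (Some x)) => [z|]; last first.
  by have := minb b; rewrite E eqxx ltnn => /(_ isT).
have zx := iter_pactV E; rewrite /= E in bN.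
have exl : exists l, iter l f (Some z) == None.
  by exists i; rewrite (nper_back b).
case: (ex_minnP exl) => l /eqP lN minl.
exists l, z, b; split=> //.
- by apply: minl; rewrite (nper_back b).
- rewrite ltnNge; apply/negP=> le_lb; move: zx.
  by rewrite -(subnK le_lb) iterD lN iter_pactN.
by split=> // j lt_jl /eqP/minl; lia.
Qed.

End Trajectories.

(** * Monogenic inverse submonoids of the symmetric inverse monoid *)

(** Periodic points distinguish words through the shift modulo [r], because
    the image of [m ^+ i] consists of periodic points; chains distinguish them
    through [walk], where by [walk_shrink] a chain with [i] points, the
    longest that occurs, decides for all. So the equality of words in [m]
    depends on [i] and [r] alone. *)
Lemma word_eq_index_period n (m : pbij n) i r v w : index_period m i r ->
  word m v = word m w <->
  net_shift r v = net_shift r w %[mod r] /\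
  (forall j, j < i -> walk i v j = walk i w j).
Proof.
move=> mir; have [r_gt0 mi _] := mir.
have per_i o : iter r (pact m) (iter i (pact m) o) = iter i (pact m) o.
  by rewrite -iterD addnC; move/pactX_eq: mi.
split=> [E | [En Ew]].
  split.
    have : m ^+ (i + net_shift r v) = m ^+ (i + net_shift r w).
      apply/pactX_eq => o; rewrite addnC iterD [in RHS]addnC [in RHS]iterD.
      by rewrite -!pact_word_periodic // E.
    case/(expg_eq_index_period _ _ mir) => [/addnI->//|[_ _ /eqP]].
    by rewrite eqn_modDl => /eqP.
  move=> j lt_ji; have [z zi] := chain_index mir (leq_ltn_trans (leq0n j) lt_ji).
  have := pact_word_chain v zi lt_ji; rewrite E (pact_word_chain w zi lt_ji).
  have [_ _ zS] := zi.
  case Ev: (walk i v j) => [k|]; case Ew: (walk i w j) => [k'|] //=.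
  - by move/(chain_inj zi (walk_lt lt_ji Ew) (walk_lt lt_ji Ev)) ->.
  - by move/esym/zS => /(_ (walk_lt lt_ji Ev)).
  - by move/zS => /(_ (walk_lt lt_ji Ew)).
apply: pact_inj => -[x|] //.
have [per|[l [z [j [le_li lt_jl zl <-]]]]] := periodic_or_chain mir x.
  rewrite !(pact_word_periodic _ r_gt0 per) (divn_eq (net_shift r v) r).
  rewrite [in RHS](divn_eq (net_shift r w) r) En.
  have perM t o : iter r (pact m) o = o -> iter (t * r) (pact m) o = o.
    by move=> po; elim: t => // t IHt; rewrite mulSn iterD IHt.
  by rewrite addnC iterD perM // [in RHS]addnC iterD perM.
rewrite !(pact_word_chain _ zl lt_jl) !(walk_shrink (i - l) _ lt_jl).
by rewrite subnKC // !Ew //; lia.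
Qed.

(** The index and period of a generator bound those of every element of the
    inverse monoid that it generates. *)
Lemma word_index_period n (m : pbij n) i r w : index_period m i r ->
  word m w ^+ (i + r) = word m w ^+ i.
Proof.
move=> mir; rewrite -!word_wpow; apply/(word_eq_index_period _ _ mir); split.
  by rewrite !net_shift_wpow mulnDl addnC [(r * _)%N]mulnC modnMDl.
by move=> j lt_ji; apply: walk_wpow_stable; rewrite ?leq_addr.
Qed.

Definition pbij_type n (A : {set pbij n}) (v : nat * nat) : Prop :=
  exists2 m, forall x, x \in A <-> exists w, x = word m w
    & index_period m v.1 v.2.

Lemma seq_i_sum n : seq_i n = \sum_(0 <= i < n.+1) seq_s (n - i).
Proof.
rewrite -size_realizable_pairs.
apply: (@num_types_size _ _ _ _ (@pbij_type n)); first exact: uniq_realizable_pairs.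
- move=> A [_ [m /submonoid_generated_wordP genA]].
  have [j [q [q_gt0 mj]]] := pigeonhole_nat (fun j => m ^+ j).
  have [i [r mir]] := index_period_exists q_gt0 mj.
  exists (i, r); last by exists m.
  by have [le_in ro] := index_period_pbij mir; rewrite mem_realizable_pairs ltnS le_in.
- case=> i r; rewrite mem_realizable_pairs ltnS => /andP[le_in ro].
  have [m mir] := pbij_index_period le_in ro.
  pose A : {set pbij n} := [set x | `[< exists w, x = word m w >]].
  have genA x : x \in A <-> exists w, x = word m w.
    by rewrite inE; split=> /asboolP.
  exists A; last by exists m.
  split; last by exists m; apply/submonoid_generated_wordP.
  split; last first.
    by move=> _ /genA[w ->]; apply/genA; exists (rev (map negb w)); rewrite wordV.
  split; first by apply/genA; exists [::].
  by move=> _ _ /genA[v ->] /genA[w ->]; apply/genA; exists (v ++ w); rewrite word_cat.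
move=> A B [i r] [j s] [[subA _] _] [[subB _] _] [m genA mir] [m' genB mjs] /=.
split=> [isoAB | [eij ers]].
  suff [-> ->] : i = j /\ r = s by [].
  apply: (monoid_iso_index_period subA subB _ _ mir mjs _ _ isoAB).
  - by apply/genA; exists [:: true]; rewrite /= mulg1.
  - by apply/genB; exists [:: true]; rewrite /= mulg1.
  - by move=> _ /genA[w ->]; apply: word_index_period.
  - by move=> _ /genB[w ->]; apply: word_index_period.
rewrite -eij -ers in mjs.
apply: (monoid_iso_of_kernel _ _ (word_cat m) (word_cat m') _ genA genB (u := [::])) => //.
move=> v w; apply: (iff_trans (word_eq_index_period v w mir)).
by apply: iff_sym; apply: word_eq_index_period.
Qed.

Local Close Scope group_scope.

Theorem theorem1 (n : nat) (hn : 1 < n) :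
  seq_t n = \sum_(1 <= k < n.+1) seq_s k /\
  (seq_i n = \sum_(0 <= k < n.+1) seq_s k /\
   \sum_(0 <= k < n.+1) seq_s k = seq_t n + 1).
Proof.
have t_sum : seq_t n = \sum_(1 <= k < n.+1) seq_s k.
  rewrite seq_t_sum ?(ltnW hn) // big_add1 /= big_nat_rev.
  by apply: eq_big_nat => i /andP[_ lt_in]; rewrite add0n subKn.
split=> //; split.
  rewrite seq_i_sum big_nat_rev; apply: eq_big_nat => i /andP[_ le_in].
  by rewrite add0n subSS subKn.
by rewrite big_ltn // t_sum seq_s_perm_orders perm_orders0 addnC.
Qed.
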